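(* Let $(\Omega,\mathcal{F},\mathbb{P})$ be a probability space. (a) For the constant filtration $\mathcal{F}_t=\mathcal{F}$, $t\in\mathbb{R}_+$, the predictable $\sigma$-algebra on $\Omega\times\mathbb{R}_+$ equals $\mathcal{F}\otimes\mathcal{B}(\mathbb{R}_+)$. (b) (Measurable section) For every $S\in\mathcal{F}\otimes\mathcal{B}(\mathbb{R}_+)$ and every $\epsilon>0$ there exists an $\mathcal{F}$-measurable function $\tau:\Omega\to\mathbb{R}_+\cup\{\infty\}$ such that $[\![\tau]\!]\subseteq S$ and $\mathbb{P}^*(\pi_\Omega(S))-\mathbb{P}(\{\tau<\infty\})\le\epsilon$. (c) (Measurable projection) For every $S\in\mathcal{F}\otimes\mathcal{B}(\mathbb{R}_+)$, the set $\pi_\Omega(S)$ belongs to the $\mathbb{P}$-completion of $\mathcal{F}$.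
   Context: $\mathbb{R}_+=[0,\infty)$ and $\mathcal{B}(\mathbb{R}_+)$ is its Borel $\sigma$-algebra. Given a filtration $\{\mathcal{F}_t\}_{t\in\mathbb{R}_+}$ (no usual conditions), an optional time (stopping time) is a function $\tau:\Omega\to\mathbb{R}_+\cup\{\infty\}$ with $\{\tau\le t\}\in\mathcal{F}_t$ for all $t\in\mathbb{R}_+$. A predictable time is an optional time $\rho$ for which there exists a non-decreasing sequence of optional times $\{\rho_n\}_{n\in\mathbb{N}}$ such that, for all $n$, $\rho_n<\infty$, $\rho_n\le\rho$, and $\rho_n<\rho$ on $\{0<\rho\}$, and such that $\rho_n\nearrow\rho$; all these relations hold for every $\omega\in\Omega$. For a function $\tau:\Omega\to\mathbb{R}_+\cup\{\infty\}$, its graph is $[\![\tau]\!]=\{(\omega,\tau(\omega)):\omega\in\Omega,\ \tau(\omega)<\infty\}$, and $[\![\tau,\infty[\![=\{(\omega,t)\in\Omega\times\mathbb{R}_+:\tau(\omega)\le t\}$. The predictable $\sigma$-algebra on $\Omega\times\mathbb{R}_+$ is the $\sigma$-algebra generated by the sets $[\![\rho,\infty[\![$ with $\rho$ a predictable time. $\pi_\Omega:\Omega\times\mathbb{R}_+\to\Omega$ is the projection $\pi_\Omega(\omega,t)=\omega$. For $A\subseteq\Omega$, $\mathbb{P}^*(A)=\inf\{\mathbb{P}(E):A\subseteq E,\ E\in\mathcal{F}\}$. *)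

(* Defs.v *)
From HB Require Import structures.
From mathcomp Require Import all_boot all_order all_algebra.
From mathcomp Require Import all_classical all_reals all_analysis.

Set Implicit Arguments.
Unset Strict Implicit.
Unset Printing Implicit Defensive.
Import Order.TTheory GRing.Theory Num.Theory.
Import numFieldNormedType.Exports.

Local Open Scope classical_set_scope.
Local Open Scope ring_scope.

Definition Rplus (R : realType) : Type := {nonneg R}.

HB.instance Definition _ (R : realType) := Choice.on (Rplus R).
HB.instance Definition _ (R : realType) :=
  isPointed.Build (Rplus R) (0%:nng : {nonneg R}).

Definition Rplus_val (R : realType) (t : Rplus R) : R :=
  (t : {nonneg R})%:num.

(* The Borel sigma-algebra of [0, +oo[ is the trace of the one of R. *)
HB.instance Definition _ (R : realType) := Measurable.copy (Rplus R)
  (g_sigma_algebra_preimageType (@Rplus_val R)).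

Section filtration.
Context (R : realType) (d : measure_display) (Omega : measurableType d).

Record filtration := Filtration {
  filtration_sets :> Rplus R -> set (set Omega) ;
  filtration_sigma_algebra : forall t, sigma_algebra setT (filtration_sets t) ;
  filtration_sub : forall t, filtration_sets t `<=` measurable ;
  filtration_le : forall s t, Rplus_val s <= Rplus_val t ->
    filtration_sets s `<=` filtration_sets t }.

Definition cst_filtration : filtration :=
  @Filtration (fun=> measurable) (fun=> sigma_algebra_measurable Omega)
    (fun=> @subset_refl _ _) (fun _ _ _ => @subset_refl _ _).

End filtration.

Section predictable.
Context (R : realType) (d : measure_display) (Omega : measurableType d).
Local Open Scope ereal_scope.

Definition graph (tau : Omega -> \bar R) : set (Omega * Rplus R) :=
  [set p | tau p.1 = (Rplus_val p.2)%:E].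

Definition stoch_itv_cinfty (tau : Omega -> \bar R) : set (Omega * Rplus R) :=
  [set p | tau p.1 <= (Rplus_val p.2)%:E].

Definition optional_time (F : filtration R Omega) (tau : Omega -> \bar R) :=
  (forall w, 0 <= tau w) /\
  (forall t : Rplus R, F t [set w | tau w <= (Rplus_val t)%:E]).

Definition predictable_time (F : filtration R Omega) (rho : Omega -> \bar R) :=
  optional_time F rho /\
  exists rho_ : nat -> Omega -> \bar R,
    [/\ forall n, optional_time F (rho_ n),
        forall w, nondecreasing_seq (rho_ ^~ w),
        forall n w, [/\ rho_ n w < +oo, rho_ n w <= rho w &
                        0 < rho w -> rho_ n w < rho w] &
        forall w, rho_ n w @[n --> \oo] --> rho w].

Definition predictable_sigma_algebra (F : filtration R Omega) :
    set (set (Omega * Rplus R)) :=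
  <<s [set stoch_itv_cinfty rho | rho in predictable_time F] >>.

(* The library's [P^*] takes the infimum over countable covers instead. *)
Definition outer_probability (P : set Omega -> \bar R) (A : set Omega) :
    \bar R :=
  ereal_inf [set P E | E in [set E | measurable E /\ A `<=` E]].

End predictable.

(* Main.v *)
Require Import Defs.
From mathcomp Require Import all_boot all_order all_algebra.
From mathcomp Require Import all_classical all_reals all_analysis.
From mathcomp Require Import measurable_realfun.

Set Implicit Arguments.
Unset Strict Implicit.
Unset Printing Implicit Defensive.
Import Order.TTheory GRing.Theory Num.Theory.
Import numFieldNormedType.Exports.

Local Open Scope classical_set_scope.
Local Open Scope ring_scope.
Local Open Scope ereal_scope.

(**
Under the constant filtration a random time that equals a constant a on an
event E and is infinite off E is predictable: it is announced by
a (1 - 1/(n+1)) on E and by n off E. The corresponding stochastic intervals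
are the products of E and [a, oo[, which generate the product sigma-algebra;
conversely [[rho, oo[[ is product measurable as soon as rho is measurable.

The section and projection theorems both follow from an inner approximation
(section_inner_approximation): if a < P^*(pi S), there is a measurable tau
whose graph lies in S and with a <= P(tau < oo). It is Choquet's
capacitability argument, carried out by hand.

- A product measurable S is Souslin over rectangles of a measurable set and a
  closed set (souslin_measurable): (w, t) belongs to S iff some sequence s of
  integers satisfies (w, t) \in K i s for all i, where K i s is a rectangle
  that depends on finitely many terms of s. Indeed the sets that are Souslin
  together with their complement form a sigma-algebra.

- P^* is continuous along increasing sequences of arbitrary sets. Hence one
  can bound t by an integer l, then the terms of s one after the other by
  g 0, g 1, and so on, keeping the outer probability of the projection above a
  at every stage (outer_probability_branch_bound).

- Let L be the part of S with a witness s <= g. The space of sequences below g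
  is compact, and so is [0, l]; therefore the projection of L, restricted to
  times at most l, is the decreasing intersection of the projections of the
  finite stages (bigcap_truncated_projection). The latter are measurable, being
  countable unions of finite intersections of measurable sets, and have
  probability at least a. Hence so does the projection of L.

- By the same compactness nonempty sections of L contain their infimum, so the
  debut of L, which is measurable by the previous point, has its graph in L.

Finally, taking the union of the sets {tau < oo} along errors tending to 0
exhausts pi S up to a subset of a null set, namely of a measurable cover of
pi S minus this union.
*)

(** * Souslin schemes *)

Definition finitary (X : Type) (f : (nat -> nat) -> X) :=
  exists N, forall s s', (forall j, (j < N)%N -> s j = s' j) -> f s = f s'.

(** The Souslin operation. The scheme reads the whole branch s, but through
finitely many terms only; compared with a scheme indexed by the finite prefixes
of s, this leaves free how many terms the i-th set reads, so that branches can
be recoded by arbitrary injections. *)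
Definition souslin (T : Type) (G : set (set T)) (S : set T) :=
  exists K : nat -> (nat -> nat) -> set T,
    [/\ forall i s, G (K i s), forall i, finitary (K i) &
        S = [set x | exists s, forall i, K i s x]].

Lemma finitary_comp (X : Type) (f : (nat -> nat) -> X) (h : nat -> nat) :
  finitary f -> finitary (fun s => f (s \o h)).
Proof.
move=> [N fN]; exists (\max_(j < N) (h j).+1)%N => s s' ss'; apply: fN => j jN.
by apply: ss'; exact: (leq_bigmax (Ordinal jN)).
Qed.

(** The finitely many sets of index below n can be controlled by one prefix. *)
Lemma finitary_family (X : Type) (K : nat -> (nat -> nat) -> X) (n : nat) :
  (forall i, finitary (K i)) ->
  exists N, forall s s', (forall j, (j < N)%N -> s j = s' j) ->
    forall i, (i < n)%N -> K i s = K i s'.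
Proof.
move=> /choice[N KN]; exists (\max_(i < n) N i)%N => s s' ss' i ltin.
apply: KN => j jN; apply: ss'; apply: (leq_trans jN).
exact: (leq_bigmax (Ordinal ltin)).
Qed.

Section souslin_operations.
Context (T : Type) (G : set (set T)).
Hypothesis GT : G setT.

Lemma souslin_base (S : set T) : G S -> souslin G S.
Proof.
move=> GS; exists (fun _ _ => S); split => //; first by move=> i; exists 0%N.
by apply/seteqP; split=> [x Sx|x [s /(_ 0%N)]] //; exists (fun=> 0%N).
Qed.

(** A witness for the intersection is a sequence of witnesses, coded as a single
branch by a pairing of the integers. *)
Lemma souslin_bigcap (S : nat -> set T) :
  (forall m, souslin G (S m)) -> souslin G (\bigcap_m S m).
Proof.
move=> /choice[K KS].
pose sub (m : nat) (s : nat -> nat) := s \o (fun j : nat => pickle (m, j)).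
exists (fun n (s : nat -> nat) =>
  if (unpickle n : option (nat * nat)) is Some (m, i) then K m i (sub m s) else setT).
split=> [n s|n|]; [| |apply/seteqP; split].
- by case: unpickle => [[m i]|] //; have [] := KS m.
- case: unpickle => [[m i]|]; last by exists 0%N.
  by apply: finitary_comp; have [] := KS m.
- move=> x Sx.
  have /choice[s sx] m : exists s, forall i, K m i s x.
    by have [_ _ Sm] := KS m; have := Sx m I; rewrite Sm; exact.
  exists (fun k => if (unpickle k : option (nat * nat)) is Some (m, j)
    then s m j else 0%N) => n.
  case: unpickle => [[m i]|] //.
  by rewrite (_ : sub m _ = s m)//; apply/funext => j; rewrite /sub /= pickleK.
- move=> x [s sx] m _; have [_ _ ->] := KS m; exists (sub m s) => i.
  by have := sx (pickle (m, i)); rewrite pickleK.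
Qed.

(** The first term of a branch tells which of the sets it testifies for, and the
rest is the witness. The sets of the scheme are indexed by pairs (m, i) and put
a constraint only on branches that begin with m; otherwise the prefix read by
the i-th set would depend on m without bound. *)
Lemma souslin_bigcup (A : nat -> set T) :
  (forall m, souslin G (A m)) -> souslin G (\bigcup_m A m).
Proof.
move=> /choice[K KS].
exists (fun n (s : nat -> nat) =>
  if (unpickle n : option (nat * nat)) is Some (m, i) then if s 0%N == m then K m i (s \o S) else setT else setT).
split=> [n s|n|]; [| |apply/seteqP; split].
- case: unpickle => [[m i]|] //; case: ifP => // _.
  by have [+ _ _] := KS m; exact.
- case: unpickle => [[m i]|]; last by exists 0%N.
  have [_ /(_ i) /(@finitary_comp _ _ S)[N KN] _] := KS m.
  exists N.+1 => s s' ss'; rewrite (ss' 0%N)//; case: ifP => // _.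
  by apply: KN => j jN; exact: (ss' j (ltnW _)).
- move=> x [m _]; have [_ _ ->] := KS m => -[s sx].
  exists (fun k => if k is j.+1 then s j else m) => n.
  case: unpickle => [[m' i]|] //=; case: eqP => // <-.
  exact: sx.
- move=> x [s sx]; exists (s 0%N) => //; have [_ _ ->] := KS (s 0%N).
  exists (s \o S) => i.
  by have := sx (pickle (s 0%N, i)); rewrite pickleK eqxx.
Qed.

(** Souslin sets are not closed under complement, whence the symmetric
condition. *)
Lemma sigma_algebra_bisouslin : G set0 ->
  sigma_algebra setT [set S | souslin G S /\ souslin G (~` S)].
Proof.
move=> G0; split=> [|A [sA sAC]|A sA].
- by rewrite /= setC0; split; exact: souslin_base.
- by rewrite setTD /= setCK.
- rewrite /= setC_bigcup; split.
    by apply: souslin_bigcup => m; have [] := sA m.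
  by apply: souslin_bigcap => m; have [] := sA m.
Qed.

End souslin_operations.

(** * Outer probability *)

Section outer_probability_theory.
Context (R : realType) (d : measure_display) (Omega : measurableType d).
Variable P : probability Omega R.
Implicit Types A E : set Omega.

Lemma outer_probability_le A E :
  measurable E -> A `<=` E -> outer_probability P A <= P E.
Proof. by move=> mE AE; apply: ereal_inf_lbound; exists E. Qed.

Lemma outer_probability_subset A B :
  A `<=` B -> outer_probability P A <= outer_probability P B.
Proof.
move=> AB; apply: le_ereal_inf => _ [E [mE BE] <-].
by exists E => //; split=> //; exact: (subset_trans AB).
Qed.

Lemma outer_probability_fin_num A : outer_probability P A \is a fin_num.
Proof.
rewrite ge0_fin_numE.
  by apply: (le_lt_trans (outer_probability_le measurableT _)) => //;
    rewrite probability_setT ltry.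
by apply: le_ereal_inf_tmp => _ [E _ <-].
Qed.

Lemma measurable_cover A :
  exists E, [/\ measurable E, A `<=` E & P E = outer_probability P A].
Proof.
have /choice[E PE] (n : nat) : exists E, [/\ measurable E, A `<=` E &
    P E < outer_probability P A + n.+1%:R^-1%:E].
  have n0 : (0 < n.+1%:R^-1 :> R)%R by rewrite invr_gt0.
  have [_ [E [mE AE] <-] lt] :=
    lb_ereal_inf_adherent n0 (outer_probability_fin_num A).
  by exists E.
have mE : measurable (\bigcap_n E n).
  by apply: bigcapT_measurable => n; have [] := PE n.
have AE : A `<=` \bigcap_n E n by move=> x Ax n _; have [_ + _] := PE n; exact.
exists (\bigcap_n E n); split => //.
apply/eqP; rewrite eq_le outer_probability_le// andbT.
apply/lee_addgt0Pr => e e0.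
have [n ne] : exists n : nat, (n.+1%:R^-1 < e)%R.
  by have [n _ /(_ n (leqnn _))] := near_infty_natSinv_lt (PosNum e0); exists n.
have [mEn _ /ltW En] := PE n; apply: (@le_trans _ _ (P (E n))).
  by apply: le_measure; rewrite ?inE//; exact: bigcap_inf.
by apply: (le_trans En); rewrite leeD2l// lee_fin ltW.
Qed.

(** Continuity from below: the sets F j, intersections of the measurable covers
of the A i for i >= j, increase with j and have the same probability as the
covers of the A j. *)
Lemma outer_probability_bigcup_gt (A : nat -> set Omega) (a : \bar R) :
  (forall m n, (m <= n)%N -> A m `<=` A n) ->
  a < outer_probability P (\bigcup_n A n) ->
  exists n, a < outer_probability P (A n).
Proof.
move=> ndA; apply: contraPP => /forallNP Aa; apply/negP; rewrite -leNgt.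
have /choice[E PE] n := measurable_cover (A n).
have mE n : measurable (E n) by have [] := PE n.
pose F j := \bigcap_(i in [set i | (j <= i)%N]) E i.
have mF j : measurable (F j) by exact: bigcap_measurableType.
have mUF : measurable (\bigcup_j F j) by exact: bigcupT_measurable.
apply: (@le_trans _ _ (P (\bigcup_j F j))).
  apply: outer_probability_le => // x [j _ Ajx]; exists j => // i /= ji.
  by have [_ + _] := PE i; apply; exact: ndA Ajx.
have ndF : nondecreasing_seq F.
  move=> m n mn; apply/subsetPset => x Fx i /= ni; apply: Fx.
  exact: leq_trans ni.
have cF := nondecreasing_cvg_mu (mu := P) mF mUF ndF.
rewrite -(cvg_lim _ cF)//; apply: lime_le; first by apply/cvg_ex; eexists; exact: cF.
apply: nearW => j /=; apply: (@le_trans _ _ (P (E j))).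
  by apply: le_measure; rewrite ?inE//; apply: bigcap_inf => /=.
by have [_ _ ->] := PE j; rewrite leNgt; apply/negP.
Qed.

(** Once the first terms of the branches are bounded, bounding the next one by
m = 0, 1, ... gives an increasing sequence of sets, so that continuity from
below provides a bound that keeps the outer probability above a. *)
Lemma outer_probability_branch_bound (B : (nat -> nat) -> set Omega)
    (a : \bar R) :
  a < outer_probability P (\bigcup_s B s) ->
  exists g : nat -> nat, forall n, a < outer_probability P
    [set w | exists2 s, (forall j, (j < n)%N -> (s j <= g j)%N) & B s w].
Proof.
move=> aB.
(* l lists the bounds already chosen. *)
pose U (l : seq nat) := [set w | exists2 s,
  (forall j, (j < size l)%N -> (s j <= nth 0%N l j)%N) & B s w].
have step l : exists m, a < outer_probability P (U l) ->
    a < outer_probability P (U (rcons l m)).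
  have [aU|aU] := pselect (a < outer_probability P (U l)); last by exists 0%N.
  have [||m Um] := @outer_probability_bigcup_gt (fun m => U (rcons l m)) a.
  - move=> m n mn w [s sl Bs]; exists s => // j jl.
    apply: (leq_trans (sl j _)); first by move: jl; rewrite !size_rcons.
    by rewrite !nth_rcons; case: ifP => // _; case: ifP.
  - apply: (lt_le_trans aU); apply: outer_probability_subset => w [s sl Bs].
    exists (s (size l)) => //; exists s => // j; rewrite size_rcons ltnS.
    rewrite leq_eqVlt nth_rcons => /predU1P[->|jl]; first by rewrite ltnn eqxx.
    by rewrite jl sl.
  - by exists m.
have [f fP] := choice step.
pose l := fix l n := if n is n'.+1 then rcons (l n') (f (l n')) else [::].
have size_l n : size (l n) = n.
  by elim: n => //= n IH; rewrite size_rcons IH.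
pose g j := f (l j).
have nth_l n j : (j < n)%N -> nth 0%N (l n) j = g j.
  elim: n => //= n IH; rewrite ltnS leq_eqVlt nth_rcons size_l.
  by move=> /predU1P[->|jn]; [rewrite ltnn eqxx|rewrite jn IH].
exists g => n; have : a < outer_probability P (U (l n)).
  elim: n => [|n IH] /=; last exact: fP.
  apply: (lt_le_trans aB); apply: outer_probability_subset => w [s _ Bs].
  by exists s.
move=> /lt_le_trans; apply; apply: outer_probability_subset => w [s sl Bs].
by exists s => // j jn; rewrite -(nth_l _ _ jn); apply: sl; rewrite size_l.
Qed.

End outer_probability_theory.

(** * The predictable sigma-algebra of the constant filtration *)

Section half_line_product.
Context (R : realType) (d : measure_display) (Omega : measurableType d).
Notation T := (Omega * Rplus R)%type.

Lemma Rplus_valP (r : R) : (0 <= r)%R -> exists t : Rplus R, Rplus_val t = r.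
Proof. by move=> r0; exists (NngNum r0). Qed.

Lemma Rplus_val_inj : injective (@Rplus_val R).
Proof. by move=> s t st; apply/val_inj. Qed.

(** The induction principle behind both the description of the predictable
sigma-algebra and the Souslin representation. *)
Lemma measurable_Rplus_prod_sub (M : set (set T)) :
  sigma_algebra setT M ->
  (forall E, measurable E -> M (fst @^-1` E)) ->
  (forall a : R, M [set p | (a <= Rplus_val p.2)%R]) ->
  (measurable : set (set T)) `<=` M.
Proof.
move=> sM ME Ma; apply: smallest_sub => // _ [] [B mB <-].
  by rewrite setTI; exact: ME.
have [C mC <-] := mB; rewrite !setTI.
have {}mC : (@RGenCInfty.G R).-sigma.-measurable C by rewrite -RGenCInfty.measurableE.
have := smallest_sub (sigma_algebra_image (@Rplus_val R \o snd) sM) _ mC.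
rewrite /image_set_system/= setTI; apply => _ [a ->] /=.
rewrite setTI (_ : _ @^-1` _ = [set p | (a <= Rplus_val p.2)%R])//.
by apply/seteqP; split=> p /=; rewrite in_itv/= andbT.
Qed.

Lemma measurable_stoch_itv_cinfty (tau : Omega -> \bar R) :
  measurable_fun setT tau -> measurable (stoch_itv_cinfty tau).
Proof.
move=> mtau.
have mval : measurable_fun [set: Rplus R] (@Rplus_val R).
  by move=> _ B mB; exists B.
have mval2 : measurable_fun [set: T] (fun p => (Rplus_val p.2)%:E).
  apply/measurable_EFinP; exact: (measurableT_comp mval).
have mtau1 : measurable_fun [set: T] (fun p => tau p.1).
  exact: (measurableT_comp mtau).
by have := measurable_lee measurableT mtau1 mval2; rewrite setTI.
Qed.

Lemma measurable_fun_sublevel (tau : Omega -> \bar R) :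
  (forall w, 0 <= tau w) ->
  (forall t : Rplus R, measurable [set w | tau w <= (Rplus_val t)%:E]) ->
  measurable_fun setT tau.
Proof.
move=> tau0 mtau; apply: (measurability _ (ErealGenOInfty.measurableE R)).
move=> _ [_ [r ->] <-]; rewrite setTI.
rewrite (_ : _ @^-1` _ = ~` [set w | tau w <= r%:E]); last first.
  apply/seteqP; split=> w /=; rewrite in_itv/= andbT ltNge => /negP //.
apply: measurableC; have [r0|r0] := leP 0%R r.
  by have [t <-] := Rplus_valP r0; exact: mtau.
rewrite (_ : [set w | _] = set0)//; apply/seteqP; split=> w //=.
by apply/negP; rewrite -ltNge (lt_le_trans _ (tau0 w))// lte_fin.
Qed.

(** If a = 0 the announcing sequence vanishes on E, in accordance with its being
below a strictly only where a is positive. *)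
Lemma predictable_time_on (E : set Omega) (a : R) :
  measurable E -> (0 <= a)%R ->
  predictable_time (cst_filtration R Omega)
    (fun w => if w \in E then a%:E else +oo).
Proof.
move=> mE a0.
have mif (f : Omega -> \bar R) (b c : \bar R) :
    (forall w, f w = if w \in E then b else c) ->
    forall x : \bar R, measurable [set w | f w <= x].
  move=> fE x; rewrite (_ : [set w | _] =
    (E `&` [set _ | b <= x]) `|` (~` E `&` [set _ | c <= x])).
    have mp (y : bool) : measurable [set _ : Omega | y].
      by case: y; rewrite ?set_true ?set_false//.
    by apply: measurableU; apply: measurableI => //; exact: measurableC.
  apply/seteqP; split=> w /=; rewrite fE.
    case: ifPn; rewrite ?notin_setE ?inE; by [left|right].
  case: ifPn; rewrite ?notin_setE ?inE => wE [] [] //.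
split; first by split=> [w|t]; [case: ifP|exact: (mif _ a%:E +oo)].
pose rho n w := if w \in E then (a * (1 - n.+1%:R^-1))%:E else n%:R%:E : \bar R.
have n1 n : (n.+1%:R^-1 <= 1 :> R)%R by rewrite invf_le1// ler1n.
exists rho; split.
- move=> n; split=> [w|t]; last exact: (mif _ (a * (1 - n.+1%:R^-1))%:E n%:R%:E).
  by rewrite /rho; case: ifP => _; rewrite lee_fin// mulr_ge0// subr_ge0.
- move=> w m n mn; rewrite /rho; case: ifP => _; rewrite lee_fin ?ler_nat//.
  by rewrite ler_wpM2l// lerD2l lerN2 lef_pV2 ?posrE// ler_nat.
- move=> n w; rewrite /rho; case: ifP => _; split; rewrite ?ltry ?leey//.
    by rewrite lee_fin ler_piMr// gerBl.
  by rewrite !lte_fin => ap; rewrite gtr_pMr// gtrBl.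
- move=> w; rewrite /rho; case: ifP => _.
    suff cva : ((a * (1 - n.+1%:R^-1))%R @[n --> \oo] --> a).
      by apply: cvg_EFin; [exact: nearW|exact: cva].
    rewrite -[X in _ --> X]mulr1 -[X in _ --> (_ * X : R)%R]subr0.
    apply: cvgMr; apply: cvgB; first exact: cvg_cst.
    exact: cvg_harmonic.
  by apply/cvgenyP; exact: cvg_id.
Qed.

Lemma predictable_cst_filtration :
  predictable_sigma_algebra (cst_filtration R Omega)
    = (measurable : set (set T)).
Proof.
apply/seteqP; split.
  apply: smallest_sub; first exact: sigma_algebra_measurable.
  move=> _ [rho [[rho0 mrho] _] <-]; apply: measurable_stoch_itv_cinfty.
  exact: measurable_fun_sublevel.
have gen (E : set Omega) (a : R) : measurable E -> (0 <= a)%R ->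
    predictable_sigma_algebra (cst_filtration R Omega)
      [set p | E p.1 /\ (a <= Rplus_val p.2)%R].
  move=> mE a0; apply: sub_sigma_algebra; eexists.
    exact: (predictable_time_on mE a0).
  apply/seteqP; split=> p; rewrite /stoch_itv_cinfty /=.
    by case: ifPn; rewrite ?inE ?lee_fin// leye_eq.
  by move=> [Ep ap]; rewrite mem_set.
have Rplus0 (t : Rplus R) : (0 <= Rplus_val t)%R by rewrite /Rplus_val.
apply: measurable_Rplus_prod_sub; first exact: smallest_sigma_algebra.
  move=> E mE; have := gen E 0%R mE (lexx _).
  rewrite (_ : [set p | _] = fst @^-1` E)//.
  by apply/seteqP; split=> p //= [].
move=> a; have := gen setT (Num.max a 0)%R measurableT.
rewrite le_max lexx orbT => /(_ isT).
rewrite (_ : [set p | _] = [set p | (a <= Rplus_val p.2)%R])//.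
by apply/seteqP; split=> p /=; rewrite ge_max Rplus0 andbT; [case|].
Qed.

End half_line_product.

(** * Product measurable sets are Souslin *)

Section measurable_section.
Context (R : realType) (d : measure_display) (Omega : measurableType d).
Notation T := (Omega * Rplus R)%type.

Definition closed_rectangle : set (set T) :=
  [set E `*` (@Rplus_val R @^-1` C) | E in measurable & C in closed].

(** The complement of a set a <= t is the countable union of the closed
conditions t <= a - 1/(n+1), hence Souslin as well. *)
Lemma souslin_measurable (S : set T) :
  measurable S -> souslin closed_rectangle S.
Proof.
have rE (E : set Omega) : measurable E -> closed_rectangle (fst @^-1` E).
  move=> mE; exists E => //; exists setT; first exact: closedT.
  by apply/seteqP; split=> p //= [].
have rC (C : set R) : closed C ->
    closed_rectangle [set p | C (Rplus_val p.2)].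
  move=> cC; exists setT => //; exists C => //.
  by apply/seteqP; split=> p //= [].
have rT : closed_rectangle setT.
  by have := rE setT measurableT; rewrite preimage_setT.
have r0 : closed_rectangle set0.
  by have := rE set0 measurable0; rewrite preimage_set0.
suff sub : (measurable : set (set T)) `<=`
    [set S | souslin closed_rectangle S /\ souslin closed_rectangle (~` S)].
  by move=> /sub[].
apply: measurable_Rplus_prod_sub; first exact: sigma_algebra_bisouslin.
  move=> E mE; split; apply: souslin_base; first exact: rE.
  by rewrite preimage_setC; apply: rE; exact: measurableC.
move=> a; split; first by apply/souslin_base/(rC [set x | a <= x]%R)/closed_ge.
rewrite (_ : ~` _ = \bigcup_n [set p : T | Rplus_val p.2 <= a - n.+1%:R^-1]%R).
  apply: souslin_bigcup => // n.
  by apply/souslin_base/(rC [set x | x <= a - n.+1%:R^-1]%R)/closed_le.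
apply/seteqP; split=> p /=.
  move=> /negP; rewrite -ltNge -subr_gt0 => lt_pa.
  exists (Num.trunc (a - Rplus_val p.2)^-1) => //=.
  rewrite lerBrDl -lerBrDr ltW// invf_plt ?posrE//.
  exact: truncnS_gt.
move=> [n _ /= pa]; apply/negP; rewrite -ltNge; apply: (le_lt_trans pa).
by rewrite gtrBl.
Qed.

(** * Compactness of the bounded branches *)

Section compact_branches.
Variables (K : nat -> (nat -> nat) -> set T) (g : nat -> nat).
Hypothesis rectK : forall i s, closed_rectangle (K i s).
Hypothesis finK : forall i, finitary (K i).

Definition bounded_branches : set T :=
  [set p | exists2 s, (forall j, (s j <= g j)%N) & forall i, K i s p].

(** Compactness of the set of sequences below g: each coordinate takes finitely
many values, so it is constant along an ultrafilter. *)
Lemma ultrafilter_branch (F : set_system nat) (s : nat -> nat -> nat) :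
  UltraFilter F -> (forall n j, (s n j <= g j)%N) ->
  exists2 s', (forall j, (s' j <= g j)%N) &
    forall N, F [set n | forall j, (j < N)%N -> s n j = s' j].
Proof.
move=> UF sg.
have /choice[s' s'P] j : exists m, (m <= g j)%N /\ F [set n | s n j = m].
  have : F [set n | (s n j <= g j)%N].
    by apply: filterS filterT => n _; exact: sg.
  elim: (g j) => [|m IH] Fm.
    by exists 0%N; split=> //; apply: filterS Fm => n /=; rewrite leqn0 => /eqP.
  have [Fe|Fe] := in_ultra_setVsetC [set n | s n j = m.+1] UF.
    by exists m.+1.
  have [|k [km Fk]] := IH; last by exists k; split=> //; exact: leqW.
  apply: filterS (filterI Fm Fe) => n /= [+ /eqP ne].
  by rewrite leq_eqVlt (negPf ne).
exists s' => [j|N]; first by have [] := s'P j.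
elim: N => [|N IH]; first by apply: filterS filterT.
have [_ FN] := s'P N; apply: filterS (filterI IH FN) => n /= [ss' sN] j.
by rewrite ltnS leq_eqVlt => /predU1P[->//|]; exact: ss'.
Qed.

(** The n-th stage of the approximation from outside of the projection of
bounded_branches restricted to times at most l: only the first n conditions of
the scheme are kept, and the bound on the time is relaxed by 1/(n+1). The
relaxation makes the same compactness argument yield both the measurability
of the debut and the fact that it is attained. *)
Definition truncated_projection (l : R) (n : nat) : set Omega :=
  [set w | exists t s, [/\ (Rplus_val t <= l + n.+1%:R^-1)%R,
     (forall j, (s j <= g j)%N) & forall i, (i < n)%N -> K i s (w, t)]].

(** Witnesses (t n, s n) for the stages converge along a nonprincipal
ultrafilter. The limit satisfies every condition i: along the ultrafilter,
s n agrees with the limit branch on the terms read by K i, and K i has closed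
sections. *)
Lemma compact_branches (w : Omega) (l : R) :
  (forall n, truncated_projection l n w) ->
  exists t, (Rplus_val t <= l)%R /\ bounded_branches (w, t).
Proof.
move=> /choice[t /choice[s tsP]].
have [F [UF sF]] := ultraFilterLemma (@eventually_filter : ProperFilter \oo).
have FP : ProperFilter F := ultra_proper.
have [s' s'g Fs'] : exists2 s', (forall j, (s' j <= g j)%N) &
    forall N, F [set n | forall j, (j < N)%N -> s n j = s' j].
  by apply: ultrafilter_branch => n; have [] := tsP n.
have t0 n : (0 <= Rplus_val (t n))%R by rewrite /Rplus_val.
have [r [r0 tr]] : exists r : R, (0 <= r)%R /\ Rplus_val (t n) @[n --> F] --> r.
  have FG : ProperFilter (Rplus_val (t n) @[n --> F]) by exact: fmap_proper_filter.
  have UG : UltraFilter (Rplus_val (t n) @[n --> F]).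
    (* The image of an ultrafilter is an ultrafilter. *)
    split=> // G PG FG'; apply/seteqP; split=> // A GA.
    have [//|FA] := in_ultra_setVsetC (((@Rplus_val R) \o t) @^-1` A) UF.
    have [x [Ax]] := filter_ex (filterI GA (FG' (~` A) FA)).
    by case.
  have := @segment_compact R 0%R (l + 1)%R.
  rewrite compact_ultra => /(_ _ UG)[|r []] /=.
    apply: filterS filterT => n _ /=; rewrite in_itv/= t0/=.
    have [+ _ _] := tsP n; move=> /le_trans; apply; rewrite lerD2l.
    by rewrite invf_le1// ler1n.
  by rewrite in_itv/= => /andP[r0 _] cr; exists r.
have [t' t'r] := Rplus_valP r0.
exists t'; split; last first.
  exists s' => // i; have [E mE [C cC KE]] := rectK i s'.
  have [N KN] := finK i.
  have FK : F [set n | K i s' (w, t n)].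
    have Fi : F [set n | (i < n)%N] by apply: sF; exists i.+1.
    apply: filterS (filterI (Fs' N) Fi) => n /= [ss' ltin].
    by rewrite -(KN (s n))//; have [_ _] := tsP n; apply.
  have [n] := filter_ex FK; rewrite /= -KE => -[/= Ew _]; split => //=.
  rewrite t'r; apply: (@closed_cvg _ _ F _ (fun n => Rplus_val (t n)) C cC _ r tr).
  by apply: filterS FK => m; rewrite /= -KE => -[].
rewrite t'r; apply/ler_addgt0Pr => e e0.
apply: (@closed_cvg _ _ F _ (fun n => Rplus_val (t n))
  [set x | x <= l + e]%R (@closed_le _ (l + e)%R) _ r tr).
apply: sF; near=> n => /=; have [+ _ _] := tsP n; move=> /le_trans; apply.
rewrite lerD2l ltW//; near: n; exact: near_infty_natSinv_lt (PosNum e0).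
Unshelve. all: by end_near. Qed.

(** The first n conditions depend on a prefix of s, so that s can be taken
eventually 0, that is, among countably many sequences. For a fixed s the time
and the event separate, since the conditions are rectangles. *)
Lemma measurable_truncated_projection (l : R) (n : nat) :
  measurable (truncated_projection l n).
Proof.
have [N KN] := finitary_family n finK.
pose br (u : seq nat) := nth 0%N u.
pose c := (l + n.+1%:R^-1)%R.
pose D (u : seq nat) := [set w | exists t, [/\ (Rplus_val t <= c)%R,
  (forall j, (br u j <= g j)%N) & forall i, (i < n)%N -> K i (br u) (w, t)]].
rewrite (_ : truncated_projection l n = \bigcup_u D u).
  apply: countable_bigcupT_measurable; first exact: countableP.
  move=> u; have /choice[E EP] i : exists E : set Omega, measurable E /\
      exists2 C, closed C & E `*` (@Rplus_val R @^-1` C) = K i (br u).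
    by have [E mE EC] := rectK i (br u); exists E.
  have /choice[C CP] i : exists C, E i `*` (@Rplus_val R @^-1` C) = K i (br u).
    by have [_ [C _ EC]] := EP i; exists C.
  have [[t [tc brg tC]]|nD] := pselect (exists t : Rplus R,
      [/\ (Rplus_val t <= c)%R, forall j, (br u j <= g j)%N &
          forall i, (i < n)%N -> C i (Rplus_val t)]).
    rewrite (_ : D u = \bigcap_(i in [set i | (i < n)%N]) E i).
      by apply: bigcap_measurableType => i _; have [] := EP i.
    apply/seteqP; split=> [w [t' [_ _ Kw]] i ltin|w Ew].
      by have := Kw i ltin; rewrite -CP => -[].
    exists t; split=> // i ltin; rewrite -CP; split; first exact: Ew.
    exact: tC.
  rewrite (_ : D u = set0)//; apply/seteqP; split=> // w [t [tc brg Kw]].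
  apply: nD; exists t; split=> // i ltin.
  by have := Kw i ltin; rewrite -CP => -[].
apply/seteqP; split=> [w [t [s [tl sg Kw]]]|w [u _ [t [tl ug Kw]]]].
  have su j : (j < N)%N -> br (mkseq s N) j = s j by exact: nth_mkseq.
  exists (mkseq s N) => //; exists t; split=> // [j|i ltin].
    have [jN|Nj] := ltnP j N; first by rewrite su.
    by rewrite /br nth_default// size_mkseq.
  by rewrite (KN _ s)//; exact: Kw.
by exists t, (br u).
Qed.

Lemma nonincreasing_truncated_projection (l : R) :
  nonincreasing_seq (truncated_projection l).
Proof.
move=> m n mn; apply/subsetPset => w [t [s [tl sg Kw]]]; exists t, s.
split=> // [|i ltim]; last by apply: Kw; exact: leq_trans mn.
by apply: (le_trans tl); rewrite lerD2l lef_pV2 ?posrE// ler_nat.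
Qed.

Lemma bigcap_truncated_projection (l : R) :
  [set w | exists t, (Rplus_val t <= l)%R /\ bounded_branches (w, t)] =
  \bigcap_n truncated_projection l n.
Proof.
apply/seteqP; split=> [w [t [tl [s sg Kw]]] n _|w Dw].
  by exists t, s; split=> //; rewrite (le_trans tl)// lerDl.
by apply: compact_branches => n; exact: Dw.
Qed.

Lemma measurable_bounded_branches_le (l : R) : measurable
  [set w | exists t, (Rplus_val t <= l)%R /\ bounded_branches (w, t)].
Proof.
rewrite bigcap_truncated_projection; apply: bigcapT_measurable => n.
exact: measurable_truncated_projection.
Qed.

Lemma bounded_branches_right_closed (w : Omega) (l : R) :
  (forall n : nat, exists t,
     (Rplus_val t <= l + n.+1%:R^-1)%R /\ bounded_branches (w, t)) ->
  exists t, (Rplus_val t <= l)%R /\ bounded_branches (w, t).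
Proof.
move=> Lw; apply: compact_branches => n.
by have [t [tl [s sg Kw]]] := Lw n; exists t, s.
Qed.

End compact_branches.

(** * The debut *)

Definition debut (L : set T) (w : Omega) : \bar R :=
  ereal_inf [set (Rplus_val t)%:E | t in [set t | L (w, t)]].

(** The hypotheses say that the projection of L restricted to times at most l
is measurable for every l, and that each nonempty section of L contains its
infimum. Then the infimum defining the debut is a minimum, whence its
measurability and the inclusion of its graph in L. *)
Section debut_theory.
Variable L : set T.
Hypothesis measL : forall l : R,
  measurable [set w | exists t, (Rplus_val t <= l)%R /\ L (w, t)].
Hypothesis closedL : forall w (l : R),
  (forall n : nat, exists t,
     (Rplus_val t <= l + n.+1%:R^-1)%R /\ L (w, t)) ->
  exists t, (Rplus_val t <= l)%R /\ L (w, t).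

Lemma debut_ge0 w : 0 <= debut L w.
Proof. by apply: le_ereal_inf_tmp => _ [t _ <-]; rewrite lee_fin /Rplus_val. Qed.

Lemma debut_le w t : L (w, t) -> debut L w <= (Rplus_val t)%:E.
Proof. by move=> Lwt; apply: ereal_inf_lbound; exists t. Qed.

Lemma debut_leP w (l : R) :
  debut L w <= l%:E <-> exists t, (Rplus_val t <= l)%R /\ L (w, t).
Proof.
split=> [dl|[t [tl Lwt]]]; last first.
  by apply: (le_trans (debut_le Lwt)); rewrite lee_fin.
apply: closedL => n.
have : debut L w < (l + n.+1%:R^-1)%:E.
  by apply: (le_lt_trans dl); rewrite lte_fin ltrDl invr_gt0.
move=> /ereal_inf_lt[_ [t Lwt <-]]; rewrite lte_fin => /ltW tl.
by exists t.
Qed.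

Lemma graph_debut : graph (debut L) `<=` L.
Proof.
move=> [w t] /= dt; have [|t' [t't Lwt']] := (debut_leP w (Rplus_val t)).1.
  by rewrite dt.
suff -> : t = t' by [].
apply: Rplus_val_inj; apply/eqP; rewrite eq_le t't andbT.
by rewrite -lee_fin -dt debut_le.
Qed.

Lemma measurable_debut : measurable_fun setT (debut L).
Proof.
apply: measurable_fun_sublevel debut_ge0 _ => t.
rewrite (_ : [set w | _] = [set w | exists t', (Rplus_val t' <= Rplus_val t)%R
  /\ L (w, t')]); first exact: measL.
by apply/seteqP; split=> w /=; move/debut_leP.
Qed.

End debut_theory.

(** * Section and projection *)

(** The time and then the branches are bounded while keeping the outer
probability above a; tau is the debut of the set L of bounded branches. *)
Lemma section_inner_approximation (P : probability Omega R) (S : set T)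
    (a : \bar R) :
  measurable S -> a < outer_probability P (fst @` S) ->
  exists tau : Omega -> \bar R, [/\ forall w, 0 <= tau w,
    measurable_fun setT tau, graph tau `<=` S & a <= P [set w | tau w < +oo]].
Proof.
move=> /souslin_measurable[K [rectK finK ->]] aS.
pose B (l : nat) s := [set w | exists t : Rplus R, (Rplus_val t <= l%:R)%R /\
  forall i, K i s (w, t)].
have [l al] : exists l : nat, a < outer_probability P (\bigcup_s B l s).
  apply: (@outer_probability_bigcup_gt _ _ _ P (fun l => \bigcup_s B l s)).
    move=> m n mn w [s _ [t [tm Kw]]]; exists s => //; exists t; split=> //.
    by rewrite (le_trans tm)// ler_nat.
  apply: (lt_le_trans aS); apply: outer_probability_subset.
  move=> _ [[w t] [s Kw] <-] /=.
  exists (Num.trunc (Rplus_val t)).+1 => //; exists s => //; exists t; split=> //.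
  exact/ltW/truncnS_gt.
have [g ag] := outer_probability_branch_bound al.
pose L := bounded_branches K g.
have measL := measurable_bounded_branches_le g rectK finK.
have closedL := @bounded_branches_right_closed K g rectK finK.
exists (debut L); split.
- exact: debut_ge0.
- by apply: measurable_debut; [exact: measL|exact: closedL].
- move=> p /(graph_debut closedL) [s _ Ks]; by exists s.
have mD n : measurable (truncated_projection K g l%:R n).
  exact: measurable_truncated_projection.
have mtau : measurable [set w | debut L w < +oo].
  rewrite -[X in measurable X]setTI; apply: emeasurable_fun_infty_o => //.
  by apply: measurable_debut; [exact: measL|exact: closedL].
apply: (@le_trans _ _ (P (\bigcap_n truncated_projection K g l%:R n))).
  rewrite -(cvg_lim _ (nonincreasing_cvg_mu (mu := P) _ mD _ _))//; last first.
  - exact: nonincreasing_truncated_projection.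
  - exact: bigcapT_measurable.
  - by rewrite (le_lt_trans (probability_le1 _ _)) ?ltry.
  apply: lime_ge.
    apply: ereal_nonincreasing_is_cvgn => m n mn.
    apply: le_measure; rewrite ?inE//; apply/subsetPset.
    exact: nonincreasing_truncated_projection.
  apply: nearW => n /=; have [N KN] := finitary_family n finK.
  apply: (le_trans (ltW (ag N))); apply: outer_probability_le => //.
  (* The bound g holds on the N terms read by the first n conditions, so that
     truncating s by g changes none of them. *)
  move=> w [s sg [t [tl Kw]]]; exists t, (fun j => minn (s j) (g j)).
  split=> [|j|i ltin]; [by rewrite (le_trans tl)// lerDl|exact: geq_minr|].
  by rewrite (KN _ s)// => j jN; apply/minn_idPl; exact: sg.
apply: le_measure; rewrite ?inE//; first exact: bigcapT_measurable.
rewrite -bigcap_truncated_projection// => w [t [_ Lwt]] /=.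
by rewrite (le_lt_trans (debut_le Lwt))// ltry.
Qed.

Lemma measurable_section (P : probability Omega R) (S : set T) (eps : R) :
  measurable S -> (0 < eps)%R ->
  exists tau : Omega -> \bar R, [/\ forall w, 0 <= tau w,
    measurable_fun setT tau, graph tau `<=` S &
    outer_probability P (fst @` S) - P [set w | tau w < +oo] <= eps%:E].
Proof.
move=> mS eps0; have fin := outer_probability_fin_num P (fst @` S).
have [|tau [tau0 mtau tauS lea]] := @section_inner_approximation P S
    (outer_probability P (fst @` S) - eps%:E) mS.
  by rewrite lteBlDr// lteDl// lte_fin.
exists tau; split=> //.
have finP : P [set w | tau w < +oo] \is a fin_num.
  apply: fin_num_measure; rewrite -[X in measurable X]setTI.
  exact: emeasurable_fun_infty_o.
by rewrite leeBlDr// addeC -leeBlDr.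
Qed.

(** The union A of the sets where the sections of errors 1/(n+1) are finite is
a measurable subset of the projection with the same outer probability. *)
Lemma measurable_projection (P : probability Omega R) (S : set T) :
  measurable S -> completed_algebra_gen P (fst @` S).
Proof.
move=> mS; have /choice[tau tauP] (n : nat) : exists tau : Omega -> \bar R,
    [/\ forall w, 0 <= tau w, measurable_fun setT tau, graph tau `<=` S &
    outer_probability P (fst @` S) - P [set w | tau w < +oo]
      <= (n.+1%:R^-1)%:E].
  exact: measurable_section.
pose A := \bigcup_n [set w | tau n w < +oo].
have mAn n : measurable [set w | tau n w < +oo].
  have [_ mtau _ _] := tauP n; rewrite -[X in measurable X]setTI.
  exact: emeasurable_fun_infty_o.
have mA : measurable A by exact: bigcupT_measurable.
have AS : A `<=` fst @` S.
  move=> w [n _ /= taun]; have [tau0 _ tauS _] := tauP n.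
  have fin : tau n w \is a fin_num by rewrite ge0_fin_numE.
  have [t tE] := @Rplus_valP R (fine (tau n w)) (fine_ge0 (tau0 w)).
  by exists (w, t) => //; apply: tauS; rewrite /graph/= tE fineK.
have [E [mE SE PE]] := measurable_cover P (fst @` S).
exists A => //; exists (fst @` S `\` A); last by rewrite setDUK.
exists (E `\` A); split; [exact: measurableD| |exact: setSD].
apply/eqP; rewrite eq_le measure_ge0 andbT.
have -> : P (E `\` A) = outer_probability P (fst @` S) - P A.
  rewrite measureD//; last by rewrite (le_lt_trans (probability_le1 _ _)) ?ltry.
  by rewrite (setIidr (subset_trans AS SE)); congr (_ - _); exact: PE.
apply/lee_addgt0Pr => e e0; rewrite add0e.
have [n ne] : exists n : nat, (n.+1%:R^-1 < e)%R.
  by have [n _ /(_ n (leqnn _))] := near_infty_natSinv_lt (PosNum e0); exists n.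
have [_ _ _ le] := tauP n.
apply: (@le_trans _ _ (n.+1%:R^-1)%:E); last by rewrite lee_fin ltW.
apply: (le_trans _ le); apply: leeB => //.
by apply: le_measure; rewrite ?inE// => w taun; exists n.
Qed.

End measurable_section.

Theorem mainTheorem3 (R : realType) (d : measure_display)
    (Omega : measurableType d) (P : probability Omega R) :
  [/\ predictable_sigma_algebra (cst_filtration R Omega)
        = (measurable : set (set (Omega * Rplus R))),
      (forall (S : set (Omega * Rplus R)) (eps : R),
        measurable S -> (0 < eps)%R ->
        exists tau : Omega -> \bar R,
          [/\ forall w, 0 <= tau w,
              measurable_fun [set: Omega] tau,
              graph tau `<=` S &
              outer_probability P (fst @` S) - P [set w | tau w < +oo]
                <= eps%:E]) &
      (forall S : set (Omega * Rplus R), measurable S ->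
        completed_algebra_gen P (fst @` S))].
Proof.
split; first exact: predictable_cst_filtration.
- by move=> S eps; exact: measurable_section.
- by move=> S; exact: measurable_projection.
Qed.
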